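(* Let $i,j\in I$ and let $K_{ij}:\mathcal H_j\to\mathcal H_i$ be a bounded injective operator with $K_{ij}\mathcal S_j(t)=\mathcal S_i(\lambda_{ij}t)K_{ij}$ for all $t\ge0$, where $\lambda_{ij}>0$. Let $\phi\in\mathrm{Dom}(A_j)$ satisfy $A_j\phi=\alpha\phi$. Then $K_{ij}\phi\in\mathrm{Dom}(A_i)$ and $$A_i(K_{ij}\phi)=\frac{\alpha}{\lambda_{ij}}\,K_{ij}\phi.$$ In particular, if $K_{ij}\phi\neq0$, then $K_{ij}\phi$ is an eigenvector of $A_i$ with eigenvalue $\alpha/\lambda_{ij}$; that is, $K_{ij}$ maps eigenspaces of $A_j$ into eigenspaces of $A_i$ with eigenvalue $\alpha$ rescaled to $\alpha/\lambda_{ij}$.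
   Context: Setting. For each $i$ in an index set $I$: $\mathcal H_i$ is a separable complex Hilbert space; $A_i$ is a positive (i.e. $\langle A_iu,u\rangle\ge 0$ for $u\in\mathrm{Dom}(A_i)$) self-adjoint operator on $\mathcal H_i$ with compact resolvent, whose spectrum contains at least one strictly positive eigenvalue; $\mathcal S_i(t)=e^{-tA_i}$, $t\ge0$, is the associated strongly continuous contraction semigroup. *)

(* Defs.v *)
From HB Require Import structures.
From mathcomp Require Import all_boot all_order all_algebra.
From mathcomp Require Import complex.
From mathcomp Require Import all_classical all_reals all_analysis.

Set Implicit Arguments.
Unset Strict Implicit.
Unset Printing Implicit Defensive.

Import Order.TTheory GRing.Theory Num.Theory.
Import numFieldNormedType.Exports.

Local Open Scope classical_set_scope.
Local Open Scope ring_scope.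
Local Open Scope complex_scope.

(* The inner product is linear in its first argument and conjugate-linear in
   its second. *)
HB.mixin Record CompleteNormedModule_isHilbert (R : realType) H
    of CompleteNormedModule R[i] H := {
  inner : {dot H for Num.conj} ;
  sqr_norm_inner : forall u : H, `|u| ^+ 2 = inner u u
}.

#[short(type="hilbertType")]
HB.structure Definition Hilbert (R : realType) :=
  {H of CompleteNormedModule R[i] H & CompleteNormedModule_isHilbert R H}.

Definition separable_space (T : topologicalType) :=
  exists2 D : set T, countable D & dense D.

(* A partially defined linear operator; the values of [op] outside [dom] are
   junk and are never used below. *)
Record operator (R : realType) (H : hilbertType R) := Operator {
  dom : set H ;
  op :> H -> H ;
  dom0 : dom 0 ;
  dom_linear : forall (a : R[i]) u v, dom u -> dom v -> dom (a *: u + v) ;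
  op_linear : forall (a : R[i]) u v, dom u -> dom v ->
    op (a *: u + v) = a *: op u + op v
}.

Section operators.
Context (R : realType) (H : hilbertType R).
Implicit Types (A : operator H) (T : {linear H -> H}) (z mu : R[i]).

Definition positive_op A := forall u, dom A u -> 0 <= inner (A u) u.

(* [adjoint_graph A v w]: v is in the domain of the adjoint A* and A* v = w
   (w is unique when A is densely defined). *)
Definition adjoint_graph A (v w : H) :=
  forall u, dom A u -> inner (A u) v = inner u w.

Definition self_adjoint A := dense (dom A) /\
  forall v w, adjoint_graph A v w <-> dom A v /\ A v = w.

(* [T] is the bounded, everywhere defined inverse of [A - z]. *)
Definition is_resolvent A z T := [/\ continuous T,
  forall v, dom A (T v) /\ A (T v) - z *: T v = v &
  forall u, dom A u -> T (A u - z *: u) = u].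

Definition spectrum A : set R[i] := [set z | ~ exists T, is_resolvent A z T].

Definition compact_op T := precompact (T @` [set u | `|u| <= 1]).

(* By the resolvent identity, compactness at one point of the resolvent set is
   compactness at all of them. *)
Definition compact_resolvent A :=
  exists z T, is_resolvent A z T /\ compact_op T.

Definition op_eigenvector A mu (u : H) := [/\ dom A u, u <> 0 & A u = mu *: u].

Definition op_eigenvalue A mu := exists u, op_eigenvector A mu u.

Definition op_eigenspace A mu : set H := [set u | dom A u /\ A u = mu *: u].

(* Families of operators are indexed by all of R, but only their values at
   times t >= 0 matter. *)
Implicit Type S : R -> {linear H -> H}.

Definition contraction_semigroup S := [/\
  forall u, S 0 u = u,
  forall s t, 0 <= s -> 0 <= t -> forall u, S (s + t) u = S s (S t u),
  forall t, 0 <= t -> forall u, `|S t u| <= `|u| &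
  forall u, {within `[0, +oo[, continuous (fun t => S t u)}].

Definition generator_graph S (u v : H) :=
  (t%:C)^-1 *: (S t u - u) @[t --> (0 : R)^'+] --> v.

(* S(t) = e^{-tA}: the strongly continuous contraction semigroup whose
   infinitesimal generator, domain included, is -A. *)
Definition is_exp_semigroup A S := contraction_semigroup S /\
  forall u v, generator_graph S u v <-> dom A u /\ v = - A u.

End operators.

Definition bounded_op (R : realType) (H1 H2 : hilbertType R)
    (K : {linear H1 -> H2}) :=
  exists M : R, forall u, `|K u| <= M%:C * `|u|.

(* Main.v *)
Require Import Defs.
From mathcomp Require Import all_boot all_order all_algebra.
From mathcomp Require Import complex.
From mathcomp Require Import all_classical all_reals all_analysis.

Set Implicit Arguments.
Unset Strict Implicit.
Unset Printing Implicit Defensive.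

Import Order.TTheory GRing.Theory Num.Theory.
Import numFieldNormedType.Exports.

Local Open Scope classical_set_scope.
Local Open Scope ring_scope.
Local Open Scope complex_scope.

(* The operator domains never have to be handled directly: [-A] is the
   infinitesimal generator of [S], domain included, and a bounded operator
   intertwining [S1(t)] with [S2(lambda t)] maps the difference quotients of
   [S1] at [u] to [lambda] times those of [S2] at [K u], so that it maps the
   generator of [S1] to [lambda] times that of [S2]. *)

Lemma bounded_op_continuous (R : realType) (H1 H2 : hilbertType R)
  (K : {linear H1 -> H2}) : bounded_op K -> continuous K.
Proof.
move=> [M KM]; apply: bounded_linear_continuous; apply/linear_boundedP.
(* A neighbourhood of [+oo] in [R[i]] needs a real threshold; [M%:C] is one, and every larger bound
   also works. *)
exists M%:C; split; first by rewrite complex_real.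
by move=> r /ltW Mr u; apply: le_trans (KM u) _; exact: ler_wpM2r.
Qed.

(** This is the change of time that lets difference quotients of one semigroup be sampled at [t / c]
    while those of the other are sampled at [t]. *)
Lemma cvg_at_right0_div (R : realType) (c : R) : 0 < c ->
  t / c @[t --> 0^'+] --> 0^'+.
Proof.
move=> c_gt0 P [e /= e_gt0 eP]; exists (e * c) => /=; first exact: mulr_gt0.
move=> t /=; rewrite !sub0r !normrN => te t_gt0.
apply: eP; rewrite /= ?divr_gt0// sub0r normrN normf_div (gtr0_norm c_gt0).
by rewrite ltr_pdivrMr.
Qed.

Lemma intertwining_generator_graph (R : realType) (H1 H2 : hilbertType R)
  (S1 : R -> {linear H1 -> H1}) (S2 : R -> {linear H2 -> H2})
  (K : {linear H1 -> H2}) (lambda : R) (u v : H1) :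
  continuous K -> 0 < lambda ->
  (forall t, 0 <= t -> K (S1 t u) = S2 (lambda * t) (K u)) ->
  generator_graph S1 u v -> generator_graph S2 (K u) (lambda%:C^-1 *: K v).
Proof.
move=> K_cont lambda_gt0 KS S1uv.
(* Sampling [S1] at [t / lambda] makes the intertwined time on the [S2] side exactly [t]; continuity
   of [K] then carries the limit across. *)
have := cvg_comp _ _ (cvg_at_right0_div lambda_gt0) S1uv.
move=> /(cvg_comp _ K)/(_ (K_cont v))/(cvgZl_tmp (k := lambda%:C^-1)).
(* The two quotients agree for [t > 0], where the intertwining relation applies; the factors of
   [lambda] cancel. *)
apply: cvg_trans; apply: near_eq_cvg; near=> t.
have t_gt0 : 0 < t by near: t; exact: nbhs_right_gt.
rewrite /= linearZ linearB /= KS ?divr_ge0 ?ltW// scalerA.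
have lambda_neq0 : lambda != 0 by rewrite gt_eqF.
rewrite mulrCA divff// mulr1 rmorphM fmorphV /=.
by rewrite invfM invrK mulrCA mulVf ?mulr1// fmorph_eq0.
Unshelve. all: by end_near. Qed.

Theorem proposition3p5 (R : realType) (I : Type) (H : I -> hilbertType R)
  (A : forall i, operator (H i)) (S : forall i, R -> {linear H i -> H i})
  (H_separable : forall i, separable_space (H i))
  (A_positive : forall i, positive_op (A i))
  (A_self_adjoint : forall i, self_adjoint (A i))
  (A_compact_resolvent : forall i, compact_resolvent (A i))
  (A_positive_eigenvalue : forall i, exists mu : R,
    [/\ 0 < mu, spectrum (A i) mu%:C & op_eigenvalue (A i) mu%:C])
  (S_exp : forall i, is_exp_semigroup (A i) (S i))
  (i j : I) (K : {linear H j -> H i}) (lambda : R)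
  (K_bounded : bounded_op K) (K_injective : injective K)
  (lambda_gt0 : 0 < lambda)
  (K_intertwines : forall t : R, 0 <= t ->
    forall u, K (S j t u) = S i (lambda * t) (K u))
  (alpha : R[i]) :
  (forall phi : H j, dom (A j) phi -> A j phi = alpha *: phi ->
    [/\ dom (A i) (K phi),
        A i (K phi) = (alpha / lambda%:C) *: K phi &
        K phi <> 0 -> op_eigenvector (A i) (alpha / lambda%:C) (K phi)]) /\
  (op_eigenvalue (A j) alpha -> op_eigenvalue (A i) (alpha / lambda%:C)) /\
  K @` op_eigenspace (A j) alpha `<=` op_eigenspace (A i) (alpha / lambda%:C).
Proof.
have K_eigen phi : dom (A j) phi -> A j phi = alpha *: phi ->
    dom (A i) (K phi) /\ A i (K phi) = (alpha / lambda%:C) *: K phi.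
  move=> phi_dom Aphi.
  have := proj2 ((S_exp j).2 phi (- A j phi)) (conj phi_dom erefl).
  move=> /(intertwining_generator_graph (bounded_op_continuous K_bounded)
    lambda_gt0 (fun t t_ge0 => K_intertwines t t_ge0 phi)).
  (* Existence of the limit at [K phi] is itself membership in the domain of [A i]; its value is
     [- A i (K phi)]. *)
  move=> /(proj1 ((S_exp i).2 _ _)) [Kphi_dom AK]; split=> //.
  by rewrite -[LHS]opprK -AK Aphi -scalerN -linearN opprK linearZ scalerA mulrC.
split; [|split].
- move=> phi phi_dom Aphi.
  by have [Kphi_dom AK] := K_eigen _ phi_dom Aphi; split.
- move=> [phi [phi_dom phi_neq0 Aphi]].
  have [Kphi_dom AK] := K_eigen _ phi_dom Aphi.
  (* Injectivity keeps the image of an eigenvector nonzero: [K phi = K 0] would force [phi = 0]. *)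
  exists (K phi); split=> //; rewrite -(linear0 K) => /K_injective.
  exact: phi_neq0.
- by move=> _ [phi [phi_dom Aphi] <-]; exact: K_eigen.
Qed.
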